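(* Let $G$ be a DMG with node set $\mathcal I\cup\mathcal K$ that satisfies JCI Assumptions $\{1,2,3\}$. Let $P=\mathcal{P}_{\mathrm{FCI\text{-}JCI}}(\mathrm{IM}_\sigma(G))$ denote the DPAG output by the corresponding version of FCI-JCI. Let $i\in\mathcal K$ and $j\in\mathcal I$. Then: 1. If $i$ is not adjacent to $j$ in $P$, then $i\to j$ is not in $G$. 2. If $i\to j$ in $P$, and for all system nodes $k\in\mathcal I$ such that $i\to k$ in $P$ and ($k\circ\!\!-\!\!\circ j$ or $k\circ\!\!\to j$ or $k\to j$ in $P$), the edge $k\to j$ is definitely visible in the DPAG $P^*$ obtained from $P$ by replacing the edge between $k$ and $j$ by $k\to j$, then $i\to j$ is present in $G$.
   Context: DMGs. A directed mixed graph (DMG) $G=\langle V,E,F\rangle$ has a finite node set $V$, directed edges $i\to j$ and bidirected edges $i\leftrightarrow j$ between distinct nodes; several edges between two nodes are allowed (at most one of each of $i\to j$, $i\leftarrow j$, $i\leftrightarrow j$). A walk is an alternating sequence of nodes and edges, each edge connecting consecutive nodes; a path is a walk containing each node at most once. $\mathrm{an}_G(j)$ is the set of nodes $i$ with a (possibly trivial) directed path $i\to\dots\to j$; $\mathrm{de}_G(i)=\{j:i\in\mathrm{an}_G(j)\}$; $\mathrm{sc}_G(i)=\mathrm{an}_G(i)\cap\mathrm{de}_G(i)$; $\mathrm{an}_G(I)=\bigcup_{i\in I}\mathrm{an}_G(i)$. A non-endpoint node on a walk is a collider if both adjacent walk edges have an arrowhead at it; other nodes on it are non-colliders. $\sigma$-separation.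 A walk is $\sigma$-blocked by $C\subseteq V$ if: its first or last node is in $C$; or it contains a collider not in $\mathrm{an}_G(C)$; or it contains a non-endpoint non-collider $k\in C$ with a directed walk edge $k\to l$ to a neighbouring node $l$ on the walk with $l\notin\mathrm{sc}_G(k)$. $A$ is $\sigma$-separated from $B$ by $C$ if all paths between nodes of $A$ and nodes of $B$ are $\sigma$-blocked by $C$. $\mathrm{IM}_\sigma(G)$ is the set of triples $\langle A,B,C\rangle$ of subsets of $V$ such that $A$ is $\sigma$-separated from $B$ by $C$. DPAGs. A directed partial ancestral graph (DPAG) is a mixed graph with edges of types $\to,\leftarrow,\leftrightarrow,\circ\!\!\to,\leftarrow\!\!\circ,\circ\!\!-\!\!\circ$, at most one edge between two distinct nodes, no self-cycles, no directed cycle and no almost directed cycle (directed path from $i$ to $j$ together with $j\leftrightarrow i$), and no inducing path between non-adjacent nodes (a path all of whose non-endpoint nodes are colliders on it and ancestors, via directed paths, of an endpoint). $*$ stands for any edge mark. A path $v_0,\dots,v_n$ is possibly directed from $v_0$ to $v_n$ if each edge between $v_{m-1}$ and $v_m$ is $v_{m-1}\circ\!\!-\!\!\circ v_m$, $v_{m-1}\circ\!\!\to v_m$ or $v_{m-1}\to v_m$; it is uncovered if $v_{m-2},v_m$ are non-adjacent for $m=2,\dots,n$. A directed edge $a\to b$ is definitely visible if there is a node $c$ not adjacent to $b$ such that either there is an edge between $c$ and $a$ that is into $a$ (has an arrowhead at $a$), or there is a collider path (all non-endpoint nodes are colliders on it) between $c$ and $a$ that is into $a$ and on which every collider is a parent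 of $b$. JCI Assumptions. The node set is a disjoint union $V=\mathcal I\cup\mathcal K$ of system nodes $\mathcal I$ and context nodes $\mathcal K$. (1) Exogeneity: for all $k\in\mathcal K,i\in\mathcal I$: $i\to k\notin G$. (2) Randomization: for all $k\in\mathcal K,i\in\mathcal I$: $i\leftrightarrow k\notin G$. (3) Genericity: for all $k\neq k'\in\mathcal K$: $k\leftrightarrow k'\in G$ and $k\to k'\notin G$. FCI-JCI for JCI Assumptions $\{1,2,3\}$ (without selection bias). Given an independence model $I$ (set of triples of subsets of $V$): distinct $i,j$ are adjacent iff there is no $Z\subseteq V\setminus\{i,j\}$ with $\langle\{i\},\{j\},Z\rangle\in I$ (context nodes are always mutually adjacent); for non-adjacent $i,j$, $\mathrm{SepSet}(i,j)$ is one such $Z$ (chosen by a fixed rule). All edges start as $\circ\!\!-\!\!\circ$. R0: for every unshielded triple $\langle a,c,b\rangle$ ($a,c$ adjacent, $c,b$ adjacent, $a,b$ non-adjacent), orient $a\,*\!\!\to c\leftarrow\!\!*\,b$ iff $c\notin\mathrm{SepSet}(a,b)$. Background orientations: every edge between $k\in\mathcal K$ and $i\in\mathcal I$ is oriented $k\to i$, and all pairs $k\ne k'\in\mathcal K$ are oriented $k\leftrightarrow k'$. Then exhaustively R1–R4. R1: if $a\,*\!\!\to b\circ\!\!-\!\!*\,c$ with $a,c$ non-adjacent, orient $b\to c$. R2: if ($a\to b\,*\!\!\to c$ or $a\,*\!\!\to b\to c$) and $a\,*\!\!-\!\!\circ c$, orient $a\,*\!\!\to c$. R3: if $a\,*\!\!\to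 b\leftarrow\!\!*\,c$, $a\,*\!\!-\!\!\circ d\circ\!\!-\!\!*\,c$, $a,c$ non-adjacent and $d\,*\!\!-\!\!\circ b$, orient $d\,*\!\!\to b$. R4: if $\langle x,\dots,a,b,c\rangle$ is a discriminating path for $b$ (at least three edges, $x,c$ non-adjacent, every node strictly between $x$ and $b$ is a collider on the path and a parent of $c$) and $b\circ\!\!-\!\!*\,c$, orient $b\to c$ if $b\in\mathrm{SepSet}(x,c)$ and $a\leftrightarrow b\leftrightarrow c$ otherwise. Then exhaustively R8a, R9, R10. R8a: if $a\to b\to c$ and $a\circ\!\!\to c$, orient $a\to c$. R9: if $a\circ\!\!\to c$ and there is an uncovered possibly directed path $\langle a,b,\dots,c\rangle$ with $b,c$ non-adjacent, orient $a\to c$. R10: if $a\circ\!\!\to c$, $b\to c\leftarrow d$, and there are uncovered possibly directed paths $\langle a,m_1,\dots,b\rangle$ and $\langle a,m_2,\dots,d\rangle$ with $m_1,m_2$ distinct and non-adjacent, orient $a\to c$. *)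

(* Defs.v *)
From Stdlib Require Export Relation_Operators.
From mathcomp Require Export all_boot.

Set Implicit Arguments.
Unset Strict Implicit.
Unset Printing Implicit Defensive.

(* Directed cycles are allowed, and so are several edges between two nodes:
   at most one of each of i -> j, j -> i and i <-> j. *)
Record dmg (V : finType) := DMG {
  dir : rel V;
  bidir : rel V;
  dir_irrefl : irreflexive dir;
  bidir_irrefl : irreflexive bidir;
  bidir_sym : symmetric bidir
}.

Section DMG.
Variables (V : finType) (G : dmg V).

Definition an (j : V) : {set V} := [set i | connect (dir G) i j].
Definition de (i : V) : {set V} := [set j | i \in an j].
Definition sc (i : V) : {set V} := an i :&: de i.
Definition an_set (C : {set V}) : {set V} := \bigcup_(c in C) an c.

End DMG.

(* The edge of a walk step from u to v: u -> v, u <- v or u <-> v. *)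
Inductive step_edge := Fwd | Bwd | Bidir.

Definition head_at_source (e : step_edge) : bool :=
  match e with Fwd => false | Bwd | Bidir => true end.
Definition head_at_target (e : step_edge) : bool :=
  match e with Bwd => false | Fwd | Bidir => true end.
Definition is_fwd (e : step_edge) : bool := if e is Fwd then true else false.
Definition is_bwd (e : step_edge) : bool := if e is Bwd then true else false.

(* The walk v0 e1 v1 ... en vn is encoded by its first node v0 and the
   sequence [:: (e1, v1); ...; (en, vn)]; since two nodes may be joined by
   several edges, the nodes alone do not determine a walk. *)
Section Walks.
Variables (V : finType) (G : dmg V).

Definition edge_in (u : V) (e : step_edge) (v : V) : bool :=
  match e with
  | Fwd => dir G u v
  | Bwd => dir G v u
  | Bidir => bidir G u v
  end.

Fixpoint is_walk (u : V) (w : seq (step_edge * V)) : bool :=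
  if w is (e, v) :: w' then edge_in u e v && is_walk v w' else true.

Definition walk_nodes (u : V) (w : seq (step_edge * V)) : seq V :=
  u :: map snd w.

Definition walk_end (u : V) (w : seq (step_edge * V)) : V :=
  last u (map snd w).

Definition is_path (u : V) (w : seq (step_edge * V)) : bool :=
  is_walk u w && uniq (walk_nodes u w).

(* The non-endpoint positions of a walk: each node k together with the edges
   and nodes before and after it, as (u, e1, k, e2, l). *)
Fixpoint inner_nodes (u : V) (w : seq (step_edge * V)) :
    seq (V * step_edge * V * step_edge * V) :=
  match w with
  | (e1, k) :: w' =>
      match w' with
      | (e2, l) :: _ => (u, e1, k, e2, l) :: inner_nodes k w'
      | [::] => [::]
      end
  | [::] => [::]
  end.

Definition blocks_at (C : {set V}) (t : V * step_edge * V * step_edge * V)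
    : bool :=
  let: (u, e1, k, e2, l) := t in
  if head_at_target e1 && head_at_source e2 then k \notin an_set G C
  else (k \in C) &&
       (is_bwd e1 && (u \notin sc G k) || is_fwd e2 && (l \notin sc G k)).

Definition sigma_blocked (C : {set V}) (u : V) (w : seq (step_edge * V))
    : bool :=
  [|| u \in C, walk_end u w \in C | has (blocks_at C) (inner_nodes u w)].

Definition sigma_separated (A B C : {set V}) : Prop :=
  forall (u : V) (w : seq (step_edge * V)),
    u \in A -> walk_end u w \in B -> is_path u w -> sigma_blocked C u w.

End Walks.

Definition indep_model (V : finType) : Type :=
  {set V} -> {set V} -> {set V} -> Prop.

Definition IM_sigma (V : finType) (G : dmg V) : indep_model V :=
  fun A B C => sigma_separated G A B C.

(* The context nodes are K, the system nodes are ~: K. *)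

Section JCI.
Variables (V : finType) (G : dmg V) (K : {set V}).

Definition exogeneity : Prop :=
  forall k i, k \in K -> i \in ~: K -> ~~ dir G i k.
Definition randomization : Prop :=
  forall k i, k \in K -> i \in ~: K -> ~~ bidir G i k.
Definition genericity : Prop :=
  forall k k', k \in K -> k' \in K -> k != k' ->
    bidir G k k' /\ ~~ dir G k k'.
Definition JCI123 : Prop := [/\ exogeneity, randomization & genericity].

End JCI.

Inductive emark := Tail | Arrow | Circle.

(* [P x y] is None when x and y are not adjacent, and otherwise [Some m] with
   m the mark AT y of the unique edge between x and y. The type imposes neither
   the symmetry of adjacency nor the conditions defining a DPAG: these are
   properties of the graphs that FCI-JCI outputs for IM_sigma. *)
Definition mixed_graph (V : finType) : Type := V -> V -> option emark.

Section MixedGraph.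
Variables (V : finType) (P : mixed_graph V).

Definition adj (x y : V) : bool := isSome (P x y).
Definition nonadj (x y : V) : bool := (x != y) && ~~ adj x y.

(* Mark at y of the edge between x and y: x *-> y, x *-o y, x *-- y. *)
Definition into (x y : V) : bool := if P x y is Some Arrow then true else false.
Definition circ_at (x y : V) : bool :=
  if P x y is Some Circle then true else false.
Definition tail_at (x y : V) : bool :=
  if P x y is Some Tail then true else false.

Definition dir_edge (x y : V) : bool := tail_at y x && into x y.
Definition circ_to (x y : V) : bool := circ_at y x && into x y.
Definition circ_circ (x y : V) : bool := circ_at y x && circ_at x y.

(* The consecutive triples of a node sequence; their middle components are
   its non-endpoint nodes. *)
Fixpoint triples (s : seq V) : seq (V * V * V) :=
  match s with
  | x :: s' =>
      match s' with
      | y :: z :: _ => (x, y, z) :: triples s'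
      | _ => [::]
      end
  | [::] => [::]
  end.

Definition mpath (x : V) (s : seq V) : bool := path adj x s && uniq (x :: s).

Definition collider (t : V * V * V) : bool :=
  let: (x, y, z) := t in into x y && into z y.

Definition collider_path (x : V) (s : seq V) : bool :=
  mpath x s && all collider (triples (x :: s)).

Definition uncovered (x : V) (s : seq V) : bool :=
  all (fun t : V * V * V => let: (u, _, w) := t in nonadj u w)
      (triples (x :: s)).

Definition possibly_directed (x : V) (s : seq V) : bool :=
  mpath x s &&
  path (fun u v => [|| circ_circ u v, circ_to u v | dir_edge u v]) x s.

Definition unc_pd_path (x : V) (s : seq V) : bool :=
  possibly_directed x s && uncovered x s.

(* <x, p, a, b, c>, with p possibly empty *)
Definition discriminating (x : V) (p : seq V) (a b c : V) : bool :=
  [&& mpath x (p ++ [:: a; b; c]), nonadj x c,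
      all collider (triples (x :: p ++ [:: a; b])) &
      all (fun q => dir_edge q c) (p ++ [:: a])].

Definition definitely_visible (a b : V) : Prop :=
  dir_edge a b /\
  exists c, nonadj c b /\
    (into c a \/
     exists p : seq V,
       [/\ collider_path c (rcons p a), into (last c p) a &
           all (fun q => dir_edge q b) p]).

Definition set_mark (x y : V) (m : emark) : mixed_graph V :=
  fun u v => if (u == x) && (v == y) then Some m else P u v.

End MixedGraph.

(* Replace the edge between x and y by x *-> y (keeping the mark at x),
   x -> y and x <-> y, respectively. *)
Definition orient_head (V : finType) (P : mixed_graph V) (x y : V) :=
  set_mark P x y Arrow.
Definition orient_dir (V : finType) (P : mixed_graph V) (x y : V) :=
  set_mark (set_mark P x y Arrow) y x Tail.
Definition orient_bidir (V : finType) (P : mixed_graph V) (x y : V) :=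
  set_mark (set_mark P x y Arrow) y x Arrow.

Section FCIJCI.
Variables (V : finType) (I : indep_model V) (K : {set V}).

Definition separates (Z : {set V}) (x y : V) : Prop :=
  Z \subset ~: [set x; y] /\ I [set x] [set y] Z.

Definition fci_adj (x y : V) : Prop :=
  x != y /\ ((x \in K /\ y \in K) \/ ~ exists Z, separates Z x y).

Definition skeleton (P : mixed_graph V) : Prop :=
  forall x y, (fci_adj x y -> P x y = Some Circle) /\
              (~ fci_adj x y -> P x y = None).

(* [sep] may be any choice of separating sets for the unordered pairs of
   non-adjacent nodes. *)
Definition is_sepset (P : mixed_graph V) (sep : V -> V -> {set V}) : Prop :=
  (forall x y, nonadj P x y -> separates (sep x y) x y) /\
  (forall x y, sep x y = sep y x).

(* All unshielded triples <x, y, z> at once; arrowheads are only added, so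
   the order is irrelevant. *)
Definition rule0 (sep : V -> V -> {set V}) (P : mixed_graph V)
    : mixed_graph V :=
  fun x y =>
    if adj P x y &&
       [exists z, [&& adj P z y, nonadj P x z & y \notin sep x z]]
    then Some Arrow else P x y.

(* Mark at y: k -> i between k \in K and i \notin K, and k <-> k' within K. *)
Definition background (P : mixed_graph V) : mixed_graph V :=
  fun x y =>
    if adj P x y then
      if x \in K then Some Arrow
      else if y \in K then Some Tail
      else P x y
    else None.

Inductive rules1_4 (sep : V -> V -> {set V}) (P : mixed_graph V) :
    mixed_graph V -> Prop :=
| rule1 a b c :
    into P a b -> adj P b c -> circ_at P c b -> nonadj P a c ->
    rules1_4 sep P (orient_dir P b c)
| rule2 a b c :
    (dir_edge P a b && into P b c) || (into P a b && dir_edge P b c) ->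
    circ_at P a c ->
    rules1_4 sep P (orient_head P a c)
| rule3 a b c d :
    into P a b -> into P c b -> circ_at P a d -> circ_at P c d ->
    nonadj P a c -> circ_at P d b ->
    rules1_4 sep P (orient_head P d b)
| rule4_in x p a b c :
    discriminating P x p a b c -> circ_at P c b -> b \in sep x c ->
    rules1_4 sep P (orient_dir P b c)
| rule4_notin x p a b c :
    discriminating P x p a b c -> circ_at P c b -> b \notin sep x c ->
    rules1_4 sep P (orient_bidir (orient_bidir P a b) b c).

Inductive rules8_10 (P : mixed_graph V) : mixed_graph V -> Prop :=
| rule8a a b c :
    dir_edge P a b -> dir_edge P b c -> circ_to P a c ->
    rules8_10 P (orient_dir P a c)
| rule9 a b c p :
    circ_to P a c -> unc_pd_path P a (b :: rcons p c) -> nonadj P b c ->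
    rules8_10 P (orient_dir P a c)
(* m1 may be b and m2 may be d *)
| rule10 a b c d m1 p1 m2 p2 :
    circ_to P a c -> dir_edge P b c -> dir_edge P d c ->
    unc_pd_path P a (m1 :: p1) -> last m1 p1 = b ->
    unc_pd_path P a (m2 :: p2) -> last m2 p2 = d ->
    nonadj P m1 m2 ->
    rules8_10 P (orient_dir P a c).

(* Every rule removes a circle mark, so runs terminate. *)
Definition exhaustively (R : mixed_graph V -> mixed_graph V -> Prop)
    (P Q : mixed_graph V) : Prop :=
  clos_refl_trans_1n _ R P Q /\ forall Q', ~ R Q Q'.

(* P is an output, for some choice of separating sets and some order of
   application of the rules. *)
Definition fci_jci_output (P : mixed_graph V) : Prop :=
  exists (P0 : mixed_graph V) (sep : V -> V -> {set V}) (P1 : mixed_graph V),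
    [/\ skeleton P0, is_sepset P0 sep,
        exhaustively (rules1_4 sep) (background (rule0 sep P0)) P1 &
        exhaustively rules8_10 P1 P].

End FCIJCI.

(* Main.v *)
From Stdlib Require Import Classical.
Require Import Defs.
From mathcomp Require Import all_boot.

Set Implicit Arguments.
Unset Strict Implicit.
Unset Printing Implicit Defensive.


(** If [i -> j] is absent from [G] but [i] and [j] are adjacent in [P], then no
set separates them; in particular the set [Z] of ancestors of [i] or [j] other
than [i] and [j] does not, and some path from [i] to [j] is open given [Z]. All
its inner nodes lie in [Z]. Context nodes receive no edge except bidirected
ones from other context nodes, and an open path may not leave a context node
in [Z] forwards, so this path must start with [i -> k] for a system node [k],
and [k] is an ancestor of [j]. Then [i -> k] is in [P] and the edge between [k] and [j] in
[P] is one of the three kinds in the hypothesis, which makes [k -> j]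
definitely visible. But the rest of the path enters [k] as a walk with an
arrowhead at [k] would; glued to the collider path that witnesses visibility
it makes the first node [c] of that collider path inseparable from [j],
although [c] and [j] are not adjacent in [P].

Two things need proof.

Open walks. Call the end of an edge at a node soft if it is an arrowhead, or
a tail towards the strongly connected component of that node: a walk is open
at a node of [C] exactly when both edge ends there are soft. The nodes [x]
and [y] are inseparable iff they are joined by an inducing walk: one whose
inner nodes are ancestors of [x] or [y] and have soft ends only
([inseparable_soft_conn] and [soft_conn_not_separated]). The second of these
lemmas is stronger: ancestors of [x], [y] or [C] that are outside [C] may be
passed with any edge ends, so that a walk may be assembled from inducing walks
without first being made into an open path.

Soundness of the orientations ([sound]). Adjacency in [P] is inseparability;
an arrowhead at [y] on the edge between [x] and [y] means that [y] is not an
ancestor of [x] in [G], a tail that it is. Ancestry in [G] is only a preorder,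
since [G] may have cycles. Where the argument for acyclic graphs uses
antisymmetry, [inducing_scc] takes its place: if [a] is inseparable from [b]
and [b] is not an ancestor of [a], then [a] is inseparable from the whole
strongly connected component of [b]. So the middle node of an unshielded
triple cannot share its component with an end node while lacking a directed
path to the other end node. *)

(** * Soft edge ends and inducing walks *)

Section SoftWalks.
Variables (V : finType) (G : dmg V).
Implicit Types (x y z u v k l a b c : V) (D S C : {set V}).
Implicit Types (e f : step_edge) (w : seq (step_edge * V)).

Local Notation "x ~> y" := (connect (dir G) x y) (at level 70).

Lemma in_sc x y : (x \in sc G y) = (x ~> y) && (y ~> x).
Proof. by rewrite !inE. Qed.

Lemma an_setP C x : reflect (exists2 c, c \in C & x ~> c) (x \in an_set G C).
Proof.
by apply: (iffP bigcupP) => -[c cC xc]; exists c => //; move: xc; rewrite inE.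
Qed.

Lemma sub_an_set C : C \subset an_set G C.
Proof. by apply/subsetP => c cC; apply/an_setP; exists c. Qed.

Lemma an_set_closed C x y : x ~> y -> y \in an_set G C -> x \in an_set G C.
Proof.
by move=> xy /an_setP[c cC yc]; apply/an_setP; exists c => //; apply: connect_trans yc.
Qed.

Lemma an_set_sub C C' : C \subset an_set G C' -> an_set G C \subset an_set G C'.
Proof.
by move=> /subsetP sCC'; apply/subsetP => x /an_setP[c /sCC' ? xc]; exact: an_set_closed xc _.
Qed.

Lemma in_an2 x a b : (x \in an_set G [set a; b]) = (x ~> a) || (x ~> b).
Proof.
apply/an_setP/orP => [[c /set2P[]->]|[]]; try by auto.
  by exists a; rewrite // set21.
by exists b; rewrite // set22.
Qed.

(** Within a strongly connected component any two nodes behave as if joined by a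
bidirected edge. This is why a tail pointing into the component counts as an
arrowhead. *)
Definition soft_out k e l := head_at_source e || (l \in sc G k).
Definition soft_in u e k := head_at_target e || (u \in sc G k).

Definition soft_start u w := if w is (e, v) :: _ then soft_out u e v else true.
Fixpoint soft_end u w :=
  match w with
  | [::] => true
  | (e, v) :: w' => if w' is [::] then soft_in u e v else soft_end v w'
  end.

(** With [S] the conditioning set and [D] the ancestors of [S] and of the two
ends, this weakens being open: every walk open given [S] satisfies it, and
it asks nothing about colliders that are ancestors of an end only. With
[S = setT] it describes inducing walks. *)
Definition soft_at D S (t : V * step_edge * V * step_edge * V) :=
  let: (u, e, k, f, l) := t in
  (k \in D) && ((k \in S) ==> soft_in u e k && soft_out k f l).

Definition soft_walk D S u w := is_walk G u w && all (soft_at D S) (inner_nodes u w).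

Lemma soft_walk_cons D S u e v w :
  soft_walk D S u ((e, v) :: w) =
  [&& edge_in G u e v, soft_walk D S v w
    & if w is (f, l) :: _ then soft_at D S (u, e, v, f, l) else true].
Proof.
rewrite /soft_walk; case: w => [|[f l] w]; first by rewrite /= !andbT.
rewrite [inner_nodes _ _]/= [is_walk _ _ _]/= -!andbA [all _ (_ :: _)]/=.
by do !bool_congr; rewrite andbC.
Qed.

(** The flags [s] and [t] demand soft edge ends at [x] and at [y]; these are what
gluing two walks at a node of [S] consumes. The walk has at least one step, as
the flags would otherwise hold vacuously. *)
Definition soft_conn D S (s t : bool) x y :=
  exists w, [/\ w <> [::], soft_walk D S x w, walk_end x w = y,
                s ==> soft_start x w & t ==> soft_end x w].

Lemma soft_walk_sub D D' S S' u w : D \subset D' -> S' \subset S ->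
  soft_walk D S u w -> soft_walk D' S' u w.
Proof.
move=> /subsetP sD /subsetP sS /andP[ww gw]; rewrite /soft_walk ww /=.
apply: sub_all gw => -[[[[u' e] k] f] l] /andP[/sD kD' /implyP kS].
by rewrite /soft_at kD' /=; apply/implyP => /sS.
Qed.

Lemma soft_conn_sub D D' S S' s t x y : D \subset D' -> S' \subset S ->
  soft_conn D S s t x y -> soft_conn D' S' s t x y.
Proof.
move=> sD sS [w [w0 gw wE ws wt]]; exists w; split=> //; exact: soft_walk_sub gw.
Qed.

Lemma soft_conn_flags D S (s t s' t' : bool) x y : s' ==> s -> t' ==> t ->
  soft_conn D S s t x y -> soft_conn D S s' t' x y.
Proof.
move=> /implyP ss /implyP tt [w [w0 gw wE /implyP ws /implyP wt]].
by exists w; split=> //; apply/implyP; auto.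
Qed.

Lemma walk_end_cat u w1 w2 : walk_end u (w1 ++ w2) = walk_end (walk_end u w1) w2.
Proof. by rewrite /walk_end map_cat last_cat. Qed.

Lemma soft_walk_cat D S u w1 w2 :
    w1 <> [::] -> w2 <> [::] ->
    soft_walk D S u w1 -> soft_walk D S (walk_end u w1) w2 ->
    walk_end u w1 \in D ->
    (walk_end u w1 \in S -> soft_end u w1 && soft_start (walk_end u w1) w2) ->
  [/\ soft_walk D S u (w1 ++ w2), soft_start u (w1 ++ w2) = soft_start u w1
    & soft_end u (w1 ++ w2) = soft_end (walk_end u w1) w2].
Proof.
move=> + w20; elim: w1 u => [//|[e v] w1 IH] u _.
rewrite cat_cons soft_walk_cons => /and3P[uv gw1 t] gw2 kD kS.
case: w1 => [|[f l] w1] in IH gw1 t gw2 kD kS *.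
  rewrite cat0s soft_walk_cons uv.
  case: w2 => [//|[f l] w2] in w20 IH gw2 kD kS *.
  rewrite [walk_end _ _]/= in gw2 kD kS *; split=> //.
  rewrite gw2 /= kD /=; exact/implyP.
have [//|//|gw12 s1 s2] := IH v _ gw1 gw2 kD.
by rewrite soft_walk_cons uv gw12; split.
Qed.

Lemma soft_conn_cat D S (s t s' t' : bool) x k y :
    soft_conn D S s t x k -> soft_conn D S s' t' k y ->
    k \in D -> (k \in S -> t && s') ->
  soft_conn D S s t' x y.
Proof.
move=> [w1 [w10 gw1 <- s1 t1]] [w2 [w20 gw2 <- s2 t2]] kD kS.
have [|gw ss st] := soft_walk_cat w10 w20 gw1 gw2 kD.
  by move=> /kS/andP[tT sT]; rewrite (implyP t1) ?(implyP s2).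
exists (w1 ++ w2); rewrite walk_end_cat ss st; split=> //.
by case: (w1) w10.
Qed.

Definition flip e := match e with Fwd => Bwd | Bwd => Fwd | Bidir => Bidir end.

Lemma edge_in_flip u e v : edge_in G v (flip e) u = edge_in G u e v.
Proof. by case: e => //=; rewrite bidir_sym. Qed.

Lemma soft_flip u e v :
  (soft_in v (flip e) u = soft_out u e v) * (soft_out v (flip e) u = soft_in u e v).
Proof. by case: e. Qed.

Lemma soft_conn1 D S u e v : edge_in G u e v ->
  soft_conn D S (soft_out u e v) (soft_in u e v) u v.
Proof. by move=> uv; exists [:: (e, v)]; split; rewrite //= ?implybb // /soft_walk /= uv. Qed.

Lemma soft_conn_sym D S s t x y : soft_conn D S s t x y -> soft_conn D S t s y x.
Proof.
case=> w [+ + <-]; elim: w x s => [//|[e v] w IH] x s _.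
rewrite soft_walk_cons => /and3P[xv gw tt] + st.
rewrite [soft_start _ _]/= => ss.
have vx := soft_conn1 D S (etrans (edge_in_flip x e v) xv); rewrite !soft_flip in vx.
case: w => [|[f l] w] in IH gw tt st *; first exact: soft_conn_flags vx.
have /andP[vD vS] : soft_at D S (x, e, v, f, l) by [].
have {IH}wv := IH v (soft_out v f l) _ gw _ st.
have {}wv := wv ltac:(done) (implybb _).
apply: soft_conn_flags (soft_conn_cat wv vx vD _); rewrite ?implybb //.
by move/(implyP vS); rewrite andbC.
Qed.


Lemma scc_soft_conn x y D : x != y -> x ~> y -> y ~> x -> sc G y \subset D ->
  soft_conn D setT true true x y.
Proof.
move=> xNy /connectP[p pP yE] yx sD; apply: soft_conn_sub sD (subxx _) _.
have {D xNy} p0 : p <> [::] by move=> p0; rewrite yE p0 eqxx in xNy.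
rewrite {y}yE in yx *.
elim: p x pP p0 yx => [//|v p IH] x /= /andP[xv vp] _ yx.
have xv' : x ~> v by exact: connect1.
have vy : v ~> last v p by apply/connectP; exists p.
have vx := connect_trans vy yx.
have H := @soft_conn1 (sc G (last v p)) setT x Fwd v xv.
rewrite /soft_out /soft_in in_sc vx xv' /= in H.
case: p => [|z p] in IH vp yx vy H *; first exact: H.
apply: soft_conn_cat H (IH v vp _ _) _ _ => //; first exact: connect_trans yx xv'.
by rewrite in_sc vy (connect_trans yx xv').
Qed.

Definition inducing x y := x <> y /\ soft_conn (an_set G [set x; y]) setT false false x y.

Lemma inducing_sym x y : inducing x y -> inducing y x.
Proof. by case=> xNy /soft_conn_sym; rewrite setUC => ?; split=> // yx; apply: xNy. Qed.

(** If the walk left [x] by an edge [x -> v] whose tail is not soft, then [v] would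
be an ancestor of [x], which makes the tail soft, or of [y], making [x] one
too. *)
Lemma soft_conn_start x y t :
  soft_conn (an_set G [set x; y]) setT false t x y ->
  soft_conn (an_set G [set x; y]) setT (~~ (x ~> y)) t x y.
Proof.
case=> -[|[e v] w] [w0 gw wE _ st]; first by case: w0.
subst y; exists ((e, v) :: w); split=> //; clear w0 st.
apply/implyP; apply: contraR; rewrite [soft_start _ _]/= /soft_out negb_or in_sc.
move: gw; rewrite soft_walk_cons => /and3P[].
case: e => //= xv _ vD; rewrite (connect1 xv) andbT => vNx.
apply: connect_trans (connect1 xv) _.
case: w vD => [|[f l] w] //; rewrite /soft_at in_an2.
by rewrite (negbTE vNx) => /andP[].
Qed.

Lemma inducing_soft_conn D x y : inducing x y -> x \in an_set G D -> y \in an_set G D ->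
  soft_conn (an_set G D) setT (~~ (x ~> y)) (~~ (y ~> x)) x y.
Proof.
move=> [_ /soft_conn_start/soft_conn_sym]; rewrite setUC => /soft_conn_start/soft_conn_sym.
rewrite setUC => xy xD yD; apply: soft_conn_sub xy => //.
by apply: an_set_sub; apply/subsetP => z /set2P[]->.
Qed.

Lemma inducing_dir x y : dir G x y -> inducing x y.
Proof.
move=> xy; split; first by move=> E; rewrite E dir_irrefl in xy.
exact: soft_conn_flags (@soft_conn1 _ _ x Fwd y xy).
Qed.

Lemma inducing_bidir x y : bidir G x y -> inducing x y.
Proof.
move=> xy; split; first by move=> E; rewrite E bidir_irrefl in xy.
exact: soft_conn_flags (@soft_conn1 _ _ x Bidir y xy).
Qed.

Lemma an_set2l a b : a \in an_set G [set a; b].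
Proof. by rewrite in_an2 connect0. Qed.
Lemma an_set2r a b : b \in an_set G [set a; b].
Proof. by rewrite in_an2 connect0 orbT. Qed.

(** Both ends at [b] are soft when an inducing walk into [b] is prolonged by a
directed walk inside the component of [b]. *)
Lemma inducing_scc a b c :
  inducing a b -> ~~ (b ~> a) -> b ~> c -> c ~> b -> inducing a c.
Proof.
move=> ab bNa bc cb.
have [<-//|bNc] := eqVneq b c.
split; first by move=> ac; rewrite ac bc in bNa.
have bD : b \in an_set G [set a; c] by rewrite in_an2 bc orbT.
have ab' := inducing_soft_conn ab (an_set2l a c) bD.
apply: soft_conn_flags (soft_conn_cat ab' (scc_soft_conn bNc bc cb _) bD _) => //.
  apply/subsetP => z; rewrite in_sc => /andP[zc _]; rewrite in_an2 zc orbT //.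
by rewrite bNa.
Qed.

(** * Inducing walks characterize inseparability *)

(** The endpoint conditions of [sigma_blocked] are left out: they are not
inherited by the pieces of a walk. *)
Definition open_walk C u w := is_walk G u w && ~~ has (blocks_at G C) (inner_nodes u w).

Lemma open_walk_cons C u e v w :
  open_walk C u ((e, v) :: w) =
  [&& edge_in G u e v, open_walk C v w
    & if w is (f, l) :: _ then ~~ blocks_at G C (u, e, v, f, l) else true].
Proof.
rewrite /open_walk; case: w => [|[f l] w]; first by rewrite /= !andbT.
rewrite [inner_nodes _ _]/= [is_walk _ _ _]/= [has _ (_ :: _)]/= negb_or -!andbA.
by do !bool_congr; rewrite andbC.
Qed.

(** A directed stretch of an open walk ends at a collider, which is an ancestor
of [C], or at the end of the walk. *)
Lemma open_fwd_anc C D u v w : C \subset an_set G D ->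
  open_walk C u ((Fwd, v) :: w) -> walk_end v w \in an_set G D -> u \in an_set G D.
Proof.
move=> CD; elim: w u v => [|[f l] w IH] u v; rewrite open_walk_cons => /and3P[/= uv ow nb] eD.
  exact: an_set_closed (connect1 uv) _.
apply: an_set_closed (connect1 uv) _.
case: f => [||] in ow nb eD *; first exact: IH eD.
  by move: nb; rewrite negbK; apply/subsetP/an_set_sub.
by move: nb; rewrite negbK; apply/subsetP/an_set_sub.
Qed.

(** Every inner node [v] lies in [an_set G D]: either the walk leaves [v] forwards
([open_fwd_anc]), or it reached [v] backwards from a node already known to
lie there, or [v] is a collider. By the last hypothesis inner nodes are then
in [C], where being open means having soft ends. *)
Lemma open_soft_walk C D u w a :
    C \subset an_set G D -> open_walk C u w -> u \in an_set G D ->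
    walk_end u w \in an_set G D -> a \notin map snd w -> uniq (map snd w) ->
    (forall k, k \in an_set G D -> k != a -> k != walk_end u w -> k \in C) ->
  soft_walk C setT u w.
Proof.
move=> CD; elim: w u => [//|[e v] w IH] u ow uD eD aw uw DC.
move: (ow); rewrite open_walk_cons soft_walk_cons => /and3P[uv ovw nb].
have vD : w <> [::] -> v \in an_set G D.
  case: w => [//|[f l] w] in IH ow eD aw uw DC ovw nb * => _.
  have [fF|fN] := boolP (is_fwd f).
    by move: fF ovw eD; clear -CD; case: f => // _; apply: open_fwd_anc.
  have [eB|eN] := boolP (is_bwd e).
    by apply: an_set_closed uD; apply: connect1; move: eB uv; clear; case: e.
  move: nb; rewrite /= ifT ?negbK; first exact/subsetP/an_set_sub.
  by move: eN fN; clear; case: e => //; case: f.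
move: aw uw => /=; rewrite inE negb_or => /andP[aNv aw] /andP[vw uw].
have gvw : soft_walk C setT v w.
  have [->//|w0] : w = [::] \/ w <> [::] by case: (w); [left|right].
  by apply: IH => //; exact: vD.
apply/and3P; split=> //.
case: w => [//|[f l] w] in vD eD vw DC nb {ow ovw gvw IH aw uw} *.
have vC : v \in C.
  apply: DC; [exact: vD | by rewrite eq_sym |].
  by apply: contraNneq vw => ->; exact: (mem_last l (map snd w)).
move: nb; rewrite [blocks_at _ _ _]/= /soft_at vC in_setT /= /soft_in /soft_out; clear.
by case: e; case: f => /=; rewrite ?orbT ?orbF ?andbT ?negb_or ?negbK ?negbK.
Qed.

Lemma inseparable_soft_conn a b : a <> b ->
    ~ (exists Z, separates (IM_sigma G) Z a b) ->
  soft_conn (an_set G [set a; b] :\: [set a; b]) setT false false a b.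
Proof.
move=> aNb nsep; set Z := _ :\: _; apply: NNPP => nconn; apply: nsep.
exists Z; split; first by rewrite /Z setDE subsetIr.
move=> u w /set1P-> /set1P wb /andP[ww /= /andP[aw uw]].
apply: contraT; rewrite /sigma_blocked !negb_or => /and3P[_ _ nb]; case: nconn.
have w0 : w <> [::] by move=> w0; apply: aNb; rewrite -wb w0.
exists w; split=> //.
apply: (@open_soft_walk Z [set a; b] a w a) => //.
- exact: subsetDl.
- by rewrite /open_walk ww.
- exact: an_set2l.
- by rewrite wb an_set2r.
by move=> k kD ka; rewrite wb => kb; rewrite !inE negb_or ka kb.
Qed.


Lemma blocks_soft C u e k f l : k \in C ->
  ~~ blocks_at G C (u, e, k, f, l) = soft_in u e k && soft_out k f l.
Proof.
move=> kC; have kA : k \in an_set G C by apply: (subsetP (sub_an_set C)).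
rewrite /= kA kC /= /soft_in /soft_out.
by case: e; case: f => /=; rewrite ?orbT ?orbF ?andbT ?negb_or ?negbK ?negbK.
Qed.

Lemma blocks_hard C u e k f l : k \notin C ->
  blocks_at G C (u, e, k, f, l) =
  [&& head_at_target e, head_at_source f & k \notin an_set G C].
Proof. by move=> kC; rewrite /= (negbTE kC) /=; case: e; case: f. Qed.

Lemma open_cons_fwd C u e k y : edge_in G u e k -> k \notin an_set G C -> k ~> y ->
  exists w, open_walk C u ((e, k) :: w) /\ walk_end k w = y.
Proof.
move=> uk + /connectP[p pP ->{y}]; elim: p u e k pP uk => [|v p IH] u e k /= pP uk kC.
  by exists [::]; rewrite /open_walk /= uk.
have /andP[kv vp] := pP.
have vC : v \notin an_set G C.
  by apply: contra kC; apply: an_set_closed; apply: connect1.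
have [w [ow wE]] := IH k Fwd v vp kv vC.
exists ((Fwd, v) :: w); rewrite open_walk_cons uk ow; split=> //=.
have kNC : k \notin C by apply: contra kC; exact/subsetP/sub_an_set.
by rewrite andbF (negbTE kNC).
Qed.

Lemma open_rcons_bwd C k a w : k ~> a -> k \notin an_set G C -> open_walk C k w ->
  exists w', open_walk C a w' /\ walk_end a w' = walk_end k w.
Proof.
move=> /connectP[p pP ->{a}]; elim: p k w pP => [|v p IH] k w /= pP kC ow.
  by exists w.
have /andP[kv vp] := pP.
have vC : v \notin an_set G C.
  by apply: contra kC; apply: an_set_closed; apply: connect1.
have [|w' [ow' wE']] := IH v ((Bwd, k) :: w) vp vC; last by exists w'.
rewrite open_walk_cons ow /= kv /=; case: w ow => [//|[f l] w] ow.
have kNC : k \notin C by apply: contra kC; exact/subsetP/sub_an_set.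
by rewrite (negbTE kNC).
Qed.

(** Read the walk from its end towards its start and repair one node at a time.
Only a collider [k] outside [an_set G C] can block; it is an ancestor of [a]
or [b], and no node on the directed path is in [C]. If it is an ancestor of
[b], the rest of the walk is replaced by the directed path to [b]; if it is
an ancestor of [a], everything before [k] is replaced by the reversed
directed path from [a], whatever that part was: this is the second
alternative. *)
Lemma soft_open_walk C a b u e k w :
    a \notin C -> b \notin C ->
    soft_walk (an_set G (C :|: [set a; b])) C u ((e, k) :: w) -> walk_end k w = b ->
  (exists w', open_walk C u ((e, k) :: w') /\ walk_end k w' = b) \/
  (exists w', open_walk C a w' /\ walk_end a w' = b).
Proof.
move=> aC bC; elim: w u e k => [|[f l] w IH] u e k.
  by move=> /andP[/= uk _] <-; left; exists [::]; rewrite /open_walk /= uk.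
rewrite soft_walk_cons => /and3P[uk gw /andP[kD kS]] wE.
have [[w' [ow wE']]|] := IH k f l gw wE; last by right.
have [kC|kC] := boolP (k \in C).
  left; exists ((f, l) :: w'); split=> //.
  by rewrite open_walk_cons uk ow blocks_soft // (implyP kS).
have [bl|nb] := boolP (blocks_at G C (u, e, k, f, l)); last first.
  by left; exists ((f, l) :: w'); rewrite open_walk_cons uk ow nb.
move: bl; rewrite blocks_hard // => /and3P[_ _ kA].
have /orP[ka|kb] : (k ~> a) || (k ~> b).
  rewrite -in_an2; case/an_setP: kD => c; rewrite inE => /orP[cC|cab] kc.
    by case/negP: kA; apply/an_setP; exists c.
  by apply/an_setP; exists c.
- by right; have [w'' [? E]] := open_rcons_bwd ka kA ow; exists w''; rewrite E.
- by left; exact: open_cons_fwd uk kA kb.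
Qed.

Definition starts_fwd w := if w is (e, _) :: _ then is_fwd e else true.

(** A walk that starts forwards outside the ancestors of [C] never meets an open
collider, so it stays directed to its end. *)
Lemma open_fwd_tail C u w1 w2 : u \notin an_set G C -> open_walk C u (w1 ++ w2) ->
  starts_fwd (w1 ++ w2) -> starts_fwd w2.
Proof.
elim: w1 u => [//|[e v] w1 IH] u uC; rewrite cat_cons open_walk_cons.
case: e => // /and3P[/= uv ow nb] _.
have vC : v \notin an_set G C.
  by apply: contra uC; apply: an_set_closed; apply: connect1.
apply: (IH v vC ow).
by case: (w1 ++ w2) nb => [//|[[] l] w]; rewrite //= vC.
Qed.

Lemma open_catr C u w1 w2 : open_walk C u (w1 ++ w2) -> open_walk C (walk_end u w1) w2.
Proof.
elim: w1 u => [//|[e v] w1 IH] u; rewrite cat_cons open_walk_cons => /and3P[_ ow _].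
exact: IH.
Qed.

Lemma open_cat_soft C u w1 w2 : w1 <> [::] -> open_walk C u (w1 ++ w2) ->
  walk_end u w1 \in C -> soft_start (walk_end u w1) w2.
Proof.
elim: w1 u => [//|[e v] w1 IH] u _; rewrite cat_cons open_walk_cons => /and3P[_ ow nb].
case: w1 => [|s w1] in IH ow nb *; last exact: (IH v).
case: w2 nb {ow IH} => [//|[f l] w] nb vC.
by move: nb; rewrite cat0s blocks_soft // => /andP[].
Qed.

Lemma mem_walk_split v w u : v \in walk_nodes u w ->
  exists w1 w2, w = w1 ++ w2 /\ walk_end u w1 = v.
Proof.
elim: w u => [|[e k] w IH] u; first by move/[!inE]/eqP->; exists [::], [::].
rewrite in_cons => /orP[/eqP->|]; first by exists [::], ((e, k) :: w).
by move=> /IH[w1 [w2 [-> E]]]; exists ((e, k) :: w1), w2.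
Qed.

(** Loops can be cut out. The last two clauses make the induction work: they
say that replacing the part of the walk after [u] by the path found for it
does not close [u]. If [u] is in [C], only the softness of the end at [u]
matters; if [u] is no ancestor of [C], it must not turn into a collider. Both
survive the cut, since a later visit to [u] has a soft end in the first case
and leaves [u] forwards in the second ([open_fwd_tail]). *)
Lemma open_walk_path C u w : open_walk C u w ->
  exists w', [/\ open_walk C u w', uniq (walk_nodes u w'), walk_end u w' = walk_end u w,
    u \in C -> soft_start u w -> soft_start u w'
  & u \notin an_set G C -> starts_fwd w -> starts_fwd w'].
Proof.
elim: w u => [|[e k] w IH] u; first by exists [::].
rewrite open_walk_cons => /and3P[uk ow nb].
have [w' [ow' uw' wE' sw' fw']] := IH k ow.
have oe : open_walk C u ((e, k) :: w').
  rewrite open_walk_cons uk ow'.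
  case: w => [|[f l] w] in nb {IH ow} wE' sw' fw' *.
    case: w' uw' wE' => [//|[f' l'] w'] uw' wE' in ow' sw' fw' *.
    move: uw' => /andP[/negP[]]; rewrite -{1}[k]wE'; exact: (mem_last l' (map snd w')).
  case: w' => [//|[f' l'] w'] in uw' wE' ow' sw' fw' *.
  have [kC|kC] := boolP (k \in C).
    move: nb; rewrite !blocks_soft // => /andP[-> sf]; exact: sw' sf.
  rewrite blocks_hard //; apply: contra nb => /and3P[he hf kA].
  rewrite blocks_hard // he kA andbT.
  by have := fw' kA; case: (f) => //=; case: (f') hf => // _ /(_ isT).
have [ukw|ukw] := boolP (u \in walk_nodes k w'); last first.
  by exists ((e, k) :: w'); split=> //=; rewrite ukw.
have [w1 [w2 [E wE1]]] := mem_walk_split ukw.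
have oe' : open_walk C u (((e, k) :: w1) ++ w2) by rewrite cat_cons -E.
exists w2; split=> //.
- by have := open_catr oe'; rewrite /walk_end /= -/(walk_end k w1) wE1.
- by move: uw'; rewrite E /walk_nodes map_cat -cat_cons lastI cat_rcons cat_uniq => /and3P[_ _];
    rewrite -/(walk_end k w1) wE1.
- by rewrite [RHS]/walk_end /= -/(walk_end k w) -wE' E walk_end_cat wE1.
- move=> uC _; have := open_cat_soft _ oe'; rewrite /walk_end /= -/(walk_end k w1) wE1.
  by apply.
by move=> uA st; apply: (open_fwd_tail uA oe').
Qed.

Lemma soft_conn_not_separated C a b : a \notin C -> b \notin C ->
  soft_conn (an_set G (C :|: [set a; b])) C false false a b ->
  ~ sigma_separated G [set a] [set b] C.
Proof.
move=> aC bC [[|[e k] w] [w0 gw wE _ _]]; first by case: w0.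
have [w1 [ow1 wE1]] : exists w', open_walk C a w' /\ walk_end a w' = b.
  have [[w' [ow' wE']]|//] := soft_open_walk aC bC gw wE.
  by exists ((e, k) :: w').
have [w2 [/andP[ww nb] uw wE2 _ _]] := open_walk_path ow1.
move=> /(_ a w2); rewrite !inE wE2 wE1 !eqxx /is_path ww uw /sigma_blocked wE2 wE1.
by move/(_ isT isT isT); rewrite (negbTE aC) (negbTE bC) (negbTE nb).
Qed.
End SoftWalks.

(** * Context nodes *)

Section ContextNodes.
Variables (V : finType) (G : dmg V) (K : {set V}).
Hypothesis hG : JCI123 G K.
Implicit Types (x y z k : V).

Local Notation "x ~> y" := (connect (dir G) x y) (at level 70).

Lemma context_no_parent x k : k \in K -> dir G x k = false.
Proof.
case: hG => exo _ gen kK; apply/negP => xk.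
have [xK|xK] := boolP (x \in K); last by rewrite (negbTE (exo k x kK _)) ?inE in xk.
have [xE|xNk] := eqVneq x k; first by rewrite xE dir_irrefl in xk.
by have [_] := gen x k xK kK xNk; rewrite xk.
Qed.

Lemma context_an x k : k \in K -> x ~> k -> x = k.
Proof.
move=> kK /connectP[p]; elim: p x => [//|v p IH] x /= /andP[xv vp] E.
by rewrite -(IH v vp E) in kK; rewrite context_no_parent in xv.
Qed.

Lemma context_bidir k x : k \in K -> bidir G k x -> x \in K.
Proof.
case: hG => _ rand _ kK kx; apply: contraLR kx => xK.
by rewrite bidir_sym rand // inE.
Qed.

(** A walk that starts at a context node with a bidirected edge cannot leave the
context nodes: a tail at a context node is not soft, and system nodes share
neither bidirected edges with context nodes nor edges into them. *)
Lemma context_start D k e v w : k \in K ->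
    soft_walk G D setT k ((e, v) :: w) -> walk_end v w \notin K ->
  e = Fwd /\ v \notin K.
Proof.
elim: w k e v => [|[f l] w IH] k e v kK.
  move=> /andP[/= /andP[kv _] _] vK; case: e kv => kv.
  - by [].
  - by rewrite /= context_no_parent in kv.
  - by rewrite (context_bidir kK kv) in vK.
rewrite soft_walk_cons => /and3P[kv gw].
rewrite /soft_at in_setT implyTb => /and3P[_ _ sf] wK.
have eF : v \notin K -> e = Fwd.
  case: e kv => // kv vK; first by rewrite /= context_no_parent in kv.
  by rewrite (context_bidir kK kv) in vK.
suff vK : v \notin K by split=> //; exact: eF.
apply/negP => vK; have [fE lK] := IH v f l vK gw wK.
move: sf; rewrite fE /soft_out in_sc /= => /andP[lv _].
by rewrite (context_an vK lv) vK in lK.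
Qed.

Lemma context_inducing_an k x : k \in K -> x \notin K -> inducing G k x -> k ~> x.
Proof.
move=> kK xK [_ [[|[e v] w] [w0 gw wE _ _]]]; first by case: w0.
have [|eF vK] := context_start kK gw; first by rewrite -wE in xK.
rewrite eF in gw; move: gw; rewrite soft_walk_cons => /and3P[kv _ vD].
apply: connect_trans (connect1 kv) _.
case: w wE vD {w0} => [<- //|[f l] w] _; rewrite /soft_at in_an2 => /andP[/orP[] // vk _].
by rewrite (context_an kK vk) kK in vK.
Qed.

(** Context nodes, which the algorithm makes adjacent in any case, are joined by a
bidirected edge and so are inseparable as well. *)
Lemma fci_adjP x y : fci_adj (IM_sigma G) K x y <-> inducing G x y.
Proof.
split=> [[/eqP xNy [[xK yK]|nsep]]|xy].
- apply: inducing_bidir; case: hG => _ _ gen.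
  by have [] := gen x y xK yK (introN eqP xNy).
- by split=> //; apply: soft_conn_sub (inseparable_soft_conn xNy nsep); rewrite ?subsetDl.
split; first by apply/eqP; case: xy.
right=> -[Z [ZN sepZ]].
have xZ : x \notin Z by apply/negP => /(subsetP ZN); rewrite !inE eqxx.
have yZ : y \notin Z by apply/negP => /(subsetP ZN); rewrite !inE eqxx orbT.
apply: soft_conn_not_separated xZ yZ _ sepZ.
apply: (@soft_conn_sub _ G (an_set G (Z :|: [set x; y])) _ setT) => //.
have xy' := @inducing_soft_conn _ G (Z :|: [set x; y]) _ _ xy.
by apply: soft_conn_flags (xy' _ _) => //; apply: (subsetP (sub_an_set _ _));
  rewrite !inE eqxx ?orbT.
Qed.

End ContextNodes.

(** * Soundness of the orientation rules *)

Section Orientation.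
Variables (V : finType) (G : dmg V) (K : {set V}) (sep : V -> V -> {set V}).
Implicit Types (x y z a b c d : V) (P : mixed_graph V).

Local Notation "x ~> y" := (connect (dir G) x y) (at level 70).

Hypothesis sepP : forall x y, x <> y -> ~ inducing G x y ->
  separates (IM_sigma G) (sep x y) x y.

Lemma separated_not_soft_conn x y (D : {set V}) : x <> y -> ~ inducing G x y ->
  D \subset an_set G (sep x y :|: [set x; y]) ->
  ~ soft_conn G D (sep x y) false false x y.
Proof.
move=> xNy nxy sD xy; have [ZN sepZ] := sepP xNy nxy.
have xZ : x \notin sep x y by apply/negP => /(subsetP ZN); rewrite !inE eqxx.
have yZ : y \notin sep x y by apply/negP => /(subsetP ZN); rewrite !inE eqxx orbT.
by apply: soft_conn_not_separated xZ yZ _ sepZ; apply: soft_conn_sub xy.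
Qed.

Local Notation D x y := (an_set G (sep x y :|: [set x; y])).

(** The ancestral set in which walks violating the separation of [x] and [y] by
[sep x y] may run. *)
Lemma sep_closure x y z : [|| z \in sep x y, z ~> x | z ~> y] -> z \in D x y.
Proof.
rewrite -in_an2 => /orP[zS|]; first by apply: (subsetP (sub_an_set _ _)); rewrite inE zS.
apply: subsetP; apply: an_set_sub; apply: subset_trans (sub_an_set _ _).
exact: subsetUr.
Qed.

Lemma inducing_soft_conn_sep x y a b : inducing G a b ->
    [|| a \in sep x y, a ~> x | a ~> y] -> [|| b \in sep x y, b ~> x | b ~> y] ->
  soft_conn G (D x y) (sep x y) (~~ (a ~> b)) (~~ (b ~> a)) a b.
Proof.
move=> ab /sep_closure aD /sep_closure bD.
exact: soft_conn_sub (subxx _) (subsetT _) (inducing_soft_conn ab aD bD).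
Qed.

(** Otherwise the inducing walks from [a] to [c] and from [c] to [b] could be
glued at [c]: outside the separating set any edge ends will do. *)
Lemma notin_sep_nonanc a b c :
    a <> b -> ~ inducing G a b -> inducing G a c -> inducing G c b ->
  c \notin sep a b -> ~~ (c ~> a) && ~~ (c ~> b).
Proof.
move=> aNb nab ac cb cS; rewrite -negb_or; apply/negP => cab.
apply: (separated_not_soft_conn aNb nab (subxx _)).
have H1 := @inducing_soft_conn_sep a b a c ac; have H2 := @inducing_soft_conn_sep a b c b cb.
rewrite !connect0 cab !orbT in H1 H2.
apply: soft_conn_flags (soft_conn_cat (H1 _ _) (H2 _ _) (sep_closure _) _);
  rewrite ?cab ?orbT //.
by rewrite (negbTE cS).
Qed.

(** Otherwise both inducing walks have a soft end at [c] ([soft_conn_start]), and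
gluing them is allowed although [c] is in the separating set. *)
Lemma in_sep_anc a b c :
    a <> b -> ~ inducing G a b -> inducing G a c -> inducing G c b ->
  c \in sep a b -> (c ~> a) || (c ~> b).
Proof.
move=> aNb nab ac cb cS; apply: contraT; rewrite negb_or => /andP[ca cb'].
case: (separated_not_soft_conn aNb nab (subxx _)).
have H1 := @inducing_soft_conn_sep a b a c ac; have H2 := @inducing_soft_conn_sep a b c b cb.
rewrite !connect0 cS !orbT ca cb' in H1 H2.
apply: soft_conn_flags (soft_conn_cat (H1 _ _) (H2 _ _) (sep_closure _) _); rewrite ?cS //.
Qed.

(** [sound_circ] retains what the rule for unshielded triples tells by leaving a
circle in place. [sound_tail_into] is a matter of bookkeeping, not of
ancestry: within a component of [G] the other mark could not be read off from
ancestor relations. *)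
Record sound P : Prop := Sound {
  sound_adj : forall x y, adj P x y <-> inducing G x y;
  sound_into : forall x y, into P x y -> ~~ (y ~> x);
  sound_tail : forall x y, tail_at P x y -> y ~> x;
  sound_tail_into : forall x y, tail_at P x y -> into P y x;
  sound_circ : forall x y z,
    circ_at P x y -> adj P z y -> nonadj P x z -> y \in sep x z;
  sound_circ_system : forall x y, circ_at P x y -> (x \notin K) && (y \notin K) }.

Lemma adj_set_mark P x y m u v : adj P x y ->
  adj (set_mark P x y m) u v = adj P u v.
Proof.
rewrite /adj /set_mark => xy; case: ifP => // /andP[/eqP-> /eqP->].
by rewrite xy.
Qed.

Lemma sound_set_mark P x y m : sound P -> adj P x y ->
    match m with
    | Arrow => ~~ (y ~> x)
    | Tail => (y ~> x) && into P y x
    | Circle => false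
    end ->
  sound (set_mark P x y m).
Proof.
move=> sP xy mP; have xNy : x <> y by case: ((sound_adj sP x y).1 xy).
have E := adj_set_mark m _ _ xy.
have CE u v : circ_at (set_mark P x y m) u v -> circ_at P u v.
  by rewrite /circ_at /set_mark; case: ifP => // _; case: m mP {E}.
split=> [u v|u v|u v|u v|u v z|u v /CE]; last exact: (sound_circ_system sP).
- by rewrite E; exact: sound_adj.
- rewrite /into /set_mark; case: ifP => [/andP[/eqP-> /eqP->]|_]; last exact: (sound_into sP).
  by case: m mP {E CE}.
- rewrite /tail_at /set_mark; case: ifP => [/andP[/eqP-> /eqP->]|_];
    last exact: (sound_tail sP).
  by case: m mP {E CE} => // /andP[].
- rewrite /tail_at /into /set_mark; case: ifP => [/andP[/eqP-> /eqP->]|_].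
    case: m mP {E CE} => // /andP[_ yx] _; case: ifP => // /andP[/eqP yx' _].
    by case: xNy.
  move=> uv; case: ifP => [/andP[/eqP vE /eqP uE]|_]; last exact: (sound_tail_into sP).
  case: m mP {E CE} => // /andP[yx _].
  by have := sound_into sP (sound_tail_into sP uv); rewrite uE vE => /negP[].
by rewrite /nonadj !E -/(nonadj P u z) => /CE; exact: (sound_circ sP).
Qed.

Section SoundState.
Variable P : mixed_graph V.
Hypothesis sP : sound P.

Lemma adj_inducing x y : adj P x y -> inducing G x y.
Proof. by move/(sound_adj sP). Qed.

Lemma adj_sym x y : adj P x y = adj P y x.
Proof. by apply/idP/idP => /adj_inducing/inducing_sym/(sound_adj sP). Qed.

Lemma nonadj_not_inducing x y : nonadj P x y -> x <> y /\ ~ inducing G x y.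
Proof. by move=> /andP[/eqP xNy /negP nxy]; split=> // /(sound_adj sP). Qed.

Lemma nonadj_sym x y : nonadj P x y = nonadj P y x.
Proof. by rewrite /nonadj eq_sym adj_sym. Qed.

Lemma into_adj x y : into P x y -> adj P x y.
Proof. by rewrite /into /adj; case: (P x y). Qed.

Lemma circ_adj x y : circ_at P x y -> adj P x y.
Proof. by rewrite /circ_at /adj; case: (P x y). Qed.

Lemma dir_edgeP x y : dir_edge P x y -> [/\ inducing G x y, x ~> y & ~~ (y ~> x)].
Proof.
move=> /andP[tl hd]; split; [exact: adj_inducing (into_adj hd) | exact: sound_tail tl |].
exact: sound_into hd.
Qed.

(** A circle at the middle node of an unshielded triple makes it a non-collider,
hence a member of the separating set. *)
Lemma circ_anc a b c : circ_at P c b -> adj P a b -> nonadj P a c ->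
  (b ~> c) || (b ~> a).
Proof.
move=> cb ab ac; have ca : nonadj P c a by rewrite nonadj_sym.
have [cNa nca] := nonadj_not_inducing ca.
apply: (in_sep_anc cNa nca) (sound_circ sP cb ab ca); first exact/adj_inducing/circ_adj.
by apply: inducing_sym; apply: adj_inducing.
Qed.

(** This stands in for the antisymmetry of ancestry. *)
Lemma nonadj_no_scc a b c : nonadj P a c -> adj P a b -> ~~ (b ~> a) -> b ~> c ->
  ~~ (c ~> b).
Proof.
move=> /nonadj_not_inducing[_ nac] /adj_inducing ab ba bc; apply/negP => cb.
by apply: nac; apply: inducing_scc ab ba bc cb.
Qed.

Lemma sound_dir x y : adj P x y -> x ~> y -> ~~ (y ~> x) -> sound (orient_dir P x y).
Proof.
move=> xy xay yax; have sP' : sound (set_mark P x y Arrow) by apply: sound_set_mark.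
apply: sound_set_mark => //; first by rewrite adj_set_mark // adj_sym.
by rewrite xay /into /set_mark !eqxx.
Qed.

Lemma sound_head x y : adj P x y -> ~~ (y ~> x) -> sound (orient_head P x y).
Proof. by move=> xy yax; apply: sound_set_mark. Qed.
End SoundState.

Lemma sound_bidir P x y : sound P -> adj P x y -> ~~ (x ~> y) -> ~~ (y ~> x) ->
  sound (orient_bidir P x y).
Proof.
move=> sP xy xay yax; have sP' : sound (set_mark P x y Arrow) by apply: sound_set_mark.
by apply: sound_set_mark => //; rewrite adj_set_mark // (adj_sym sP).
Qed.

(** Arrowheads make the inducing walks of the successive edges soft at the
colliders, so the walks can be concatenated. *)
Lemma collider_path_soft_conn P C x s y : sound P ->
    path (adj P) x (rcons s y) -> all (collider P) (triples (x :: rcons s y)) ->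
    all [in an_set G C] (x :: rcons s y) ->
  soft_conn G (an_set G C) setT (~~ (x ~> head y s)) (~~ (y ~> last x s)) x y.
Proof.
move=> sP; elim: s x => [|z s IH] x.
  rewrite /= andbT => /(adj_inducing sP) xy _ /and3P[xC yC _]; exact: inducing_soft_conn.
rewrite rcons_cons => /=/andP[/(adj_inducing sP) xz zs].
have -> : (if rcons s y is z0 :: _ then (x, z, z0) :: triples (z :: rcons s y) else [::]) =
  (x, z, head y s) :: triples (z :: rcons s y) by case: (s).
move=> /= /andP[/andP[zx zn] cs] /andP[xC /andP[zC sC]].
have H := IH z zs cs; rewrite /= zC in H.
apply: soft_conn_flags (soft_conn_cat (inducing_soft_conn xz xC zC) (H sC) zC _);
  rewrite ?implybb //.
by rewrite (sound_into sP zx) (sound_into sP zn).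
Qed.

Lemma discriminating_soft_conn P x p a b c C : sound P -> discriminating P x p a b c ->
    (b \in an_set G C) -> x \in an_set G C -> c \in an_set G C ->
  soft_conn G (an_set G C) setT false (~~ (b ~> a)) x b.
Proof.
move=> sP /and4P[/andP[pth _] _ cP dP] bC xC cC.
have -> : a = last x (rcons p a) by rewrite last_rcons.
apply: soft_conn_flags (@collider_path_soft_conn P C x (rcons p a) b sP _ _ _);
  rewrite ?implybb //.
- move: pth; rewrite -[[:: a, b & _]]/([:: a; b] ++ [:: c]) catA cat_path => /andP[].
  by rewrite -cats1 -cats1 -catA.
- by rewrite -cats1 -cats1 -catA.
rewrite /= xC all_rcons bC /= -cats1; apply: sub_all dP => q /(dir_edgeP sP)[_ qc _].
exact: an_set_closed qc cC.
Qed.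

Lemma discriminating_ends P x p a b c : sound P -> discriminating P x p a b c ->
  [/\ nonadj P x c, inducing G a b, ~~ (a ~> b), a ~> c & ~~ (c ~> a)].
Proof.
move=> sP /and4P[/andP[pth _] xc cP].
rewrite all_cat => /and3P[_ /(dir_edgeP sP)[ac aac caa] _].
have ab : adj P a b by move: pth; rewrite cat_path => /= /and4P[].
have ba : into P b a.
  elim: p x {pth xc} cP => [|q p IH] x; first by move=> /andP[/andP[_ ba] _].
  case: p IH => [|r p] IH /andP[_]; [exact: IH q | exact: IH q].
by split=> //; [exact: (adj_inducing sP ab) | exact: (sound_into sP ba)].
Qed.

(** If [b] were no ancestor of [c], the collider path up to [b] and the inducing
walk from [b] to [c] would meet softly at [b], against the separation of [x]
and [c]. If [c] were in turn an ancestor of [b], the collider path could be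
prolonged inside the component of [b], making [x] and [c] inseparable. *)
Lemma rule4_tail P x p a b c : sound P -> discriminating P x p a b c -> adj P b c ->
  b \in sep x c -> (b ~> c) && ~~ (c ~> b).
Proof.
move=> sP disc bc bS; have [xc ab aNb aac caa] := discriminating_ends sP disc.
have [xNc nxc] := nonadj_not_inducing sP xc; have ibc := adj_inducing sP bc.
have H C := @discriminating_soft_conn P x p a b c C sP disc.
have bc' : b ~> c.
  apply: contraT => bNc; have bNa : ~~ (b ~> a).
    by apply: contra bNc => ba; exact: connect_trans ba aac.
  case: (separated_not_soft_conn xNc nxc (subxx _)).
  have bD : b \in D x c by apply: sep_closure; rewrite bS.
  have cD : c \in D x c by apply: sep_closure; rewrite connect0 !orbT.
  have xD : x \in D x c by apply: sep_closure; rewrite connect0 !orbT.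
  have Hb := soft_conn_sub (subxx _) (subsetT (sep x c)) (H _ bD xD cD).
  have Hc := soft_conn_sub (subxx _) (subsetT (sep x c)) (inducing_soft_conn ibc bD cD).
  by apply: soft_conn_flags (soft_conn_cat Hb Hc bD _) => //; rewrite bNa bNc.
rewrite bc'; apply/negP => cb.
have bNa : ~~ (b ~> a) by apply: contra caa; exact: connect_trans cb.
apply: nxc; split=> //.
have bD : b \in an_set G [set x; c] by rewrite in_an2 bc' orbT.
have Hb := H _ bD (an_set2l _ _ _) (an_set2r _ _ _).
have [bE|bNc] := eqVneq b c; first by case: ibc => /(_ bE).
apply: soft_conn_flags (soft_conn_cat Hb (scc_soft_conn bNc bc' cb _) bD _) => //.
  by apply/subsetP => z; rewrite in_sc in_an2 => /andP[-> _]; rewrite orbT.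
by rewrite bNa.
Qed.

(** As [b] is outside the separating set, the collider path and the inducing walk
from [b] to [c] could be glued at [b] if [b] were an ancestor of [c]; the
other non-ancestries follow, because [a] is a parent of [c]. *)
Lemma rule4_heads P x p a b c : sound P -> discriminating P x p a b c -> adj P b c ->
  b \notin sep x c -> [&& ~~ (b ~> a), ~~ (b ~> c) & ~~ (c ~> b)].
Proof.
move=> sP disc bc bS; have [xc ab aNb aac caa] := discriminating_ends sP disc.
have [xNc nxc] := nonadj_not_inducing sP xc; have ibc := adj_inducing sP bc.
have bNc : ~~ (b ~> c).
  apply/negP => bc'; apply: (separated_not_soft_conn xNc nxc (subxx _)).
  have bD : b \in D x c by apply: sep_closure; rewrite bc' !orbT.
  have cD : c \in D x c by apply: sep_closure; rewrite connect0 !orbT.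
  have xD : x \in D x c by apply: sep_closure; rewrite connect0 !orbT.
  have Hb := soft_conn_sub (subxx _) (subsetT (sep x c))
    (discriminating_soft_conn sP disc bD xD cD).
  have Hc := soft_conn_sub (subxx _) (subsetT (sep x c)) (inducing_soft_conn ibc bD cD).
  by apply: soft_conn_flags (soft_conn_cat Hb Hc bD _) => //; rewrite (negbTE bS).
rewrite bNc /=; apply/andP; split.
  by apply: contra bNc => ba; exact: connect_trans ba aac.
by apply: contra aNb; exact: connect_trans aac.
Qed.

Lemma rules1_4_sound P Q : sound P -> rules1_4 sep P Q -> sound Q.
Proof.
move=> sP; case=> {Q}.
- move=> a b c ab bc cb ac.
  have ba := sound_into sP ab; have aab := into_adj ab.
  have := circ_anc sP cb aab ac; rewrite (negbTE ba) orbF => bac.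
  exact: (sound_dir sP bc bac (nonadj_no_scc sP ac aab ba bac)).
- move=> a b c H ac; apply: (sound_head sP (circ_adj ac)).
  case/orP: H => /andP[].
    move=> /(dir_edgeP sP)[_ ab _] /(sound_into sP); apply: contra => ca.
    exact: connect_trans ca ab.
  move=> /(sound_into sP) + /(dir_edgeP sP)[_ bc _]; apply: contra => ca.
  exact: connect_trans bc ca.
- move=> a b c d ab cb ad cd ac db; apply: (sound_head sP (circ_adj db)).
  have /orP[da|dc] : (d ~> a) || (d ~> c).
  - have [aNc nac] := nonadj_not_inducing sP ac.
    apply: (in_sep_anc aNc nac) (sound_circ sP ad (circ_adj cd) ac).
      exact: (adj_inducing sP (circ_adj ad)).
    by apply: inducing_sym; apply: (adj_inducing sP); apply: circ_adj.
  - by apply: contra (sound_into sP ab) => bd; exact: connect_trans da.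
  - by apply: contra (sound_into sP cb) => bd; exact: connect_trans dc.
- move=> x p a b c disc cb bS.
  have bc : adj P b c by rewrite (adj_sym sP); apply: circ_adj.
  have /andP[bac cab] := rule4_tail sP disc bc bS.
  exact: (sound_dir sP bc bac cab).
move=> x p a b c disc cb bS.
have bc : adj P b c by rewrite (adj_sym sP); apply: circ_adj.
have [_ ab aNb _ _] := discriminating_ends sP disc.
have /and3P[bNa bNc cNb] := rule4_heads sP disc bc bS.
have sP' : sound (orient_bidir P a b).
  by apply: sound_bidir => //; apply/(sound_adj sP).
apply: sound_bidir => //; apply/(sound_adj sP').
exact: (adj_inducing sP bc).
Qed.

(** Direction propagates: the second node of an unshielded non-collider triple is
an ancestor of the first or of the third. The first is excluded by
hypothesis, and [nonadj_no_scc] provides this hypothesis for the next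
triple. *)
Lemma unc_pd_path_anc P a m p : sound P -> unc_pd_path P a (m :: p) ->
  a ~> m -> ~~ (m ~> a) -> a ~> last m p.
Proof.
move=> sP; elim: p a m => [//|n p IH] a m /andP[/andP[/andP[pth uq] pd] un] am mNa.
have [aam mn] : adj P a m /\ adj P m n by case/and3P: pth.
have /andP[an un'] : nonadj P a n && uncovered P m (n :: p) by [].
have mn' : m ~> n.
  have : circ_at P n m || tail_at P n m.
    by case/and3P: pd => _ /or3P[] /andP[-> _] _; rewrite ?orbT.
  move=> /orP[nm|]; last exact: (sound_tail sP).
  by have := circ_anc sP nm aam an; rewrite (negbTE mNa) orbF.
apply: connect_trans am (IH m n _ mn' (nonadj_no_scc sP an aam mNa mn')).
by apply/andP; split=> //; apply/andP; split; [apply/andP; split|];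
  [case/andP: pth | case/andP: uq | case/andP: pd].
Qed.

Lemma rules8_10_sound P Q : sound P -> rules8_10 P Q -> sound Q.
Proof.
move=> sP; case=> {Q}.
- move=> a b c /(dir_edgeP sP)[_ ab _] /(dir_edgeP sP)[_ bc _] /andP[_ ac].
  exact: (sound_dir sP (into_adj ac) (connect_trans ab bc) (sound_into sP ac)).
- move=> a b c p /andP[ca ac] up nbc.
  apply: (sound_dir sP (into_adj ac) _ (sound_into sP ac)).
  apply: contraT => aNc; have cNa := sound_into sP ac.
  have ab : adj P a b by case/andP: up => /andP[/andP[/andP[]]].
  have nbc' : nonadj P c b by rewrite (nonadj_sym sP).
  have aab : a ~> b.
    have ba : adj P b a by rewrite (adj_sym sP).
    by have := circ_anc sP ca ba nbc; rewrite (negbTE aNc).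
  rewrite -(negbTE aNc) -[c in _ ~> c](last_rcons b p); apply: (unc_pd_path_anc sP up aab).
  by apply: (nonadj_no_scc sP nbc' (circ_adj ca) aNc aab).
move=> a b c d m1 p1 m2 p2 /andP[ca ac] /(dir_edgeP sP)[_ bc _] /(dir_edgeP sP)[_ dc _].
move=> up1 E1 up2 E2 nm; apply: (sound_dir sP (into_adj ac) _ (sound_into sP ac)).
have nm' : nonadj P m2 m1 by rewrite (nonadj_sym sP).
have start m p : unc_pd_path P a (m :: p) -> adj P a m /\ (circ_at P m a || tail_at P m a).
  move=> /andP[/andP[/andP[/andP[am _] _]] /andP[pd _] _]; split=> //.
  by case/or3P: pd => /andP[-> _]; rewrite ?orbT.
have [am1 s1] := start _ _ up1; have [am2 s2] := start _ _ up2.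
have m1a : adj P m1 a by rewrite (adj_sym sP).
have m2a : adj P m2 a by rewrite (adj_sym sP).
have am : (a ~> m1) || (a ~> m2).
  case/orP: s1 => [s1|/(sound_tail sP)->//].
  exact: (circ_anc sP s1 m2a nm').
have viab : a ~> m1 -> ~~ (m1 ~> a) -> a ~> c.
  by move=> x y; apply: connect_trans bc; rewrite -E1; exact: unc_pd_path_anc up1 x y.
have viad : a ~> m2 -> ~~ (m2 ~> a) -> a ~> c.
  by move=> x y; apply: connect_trans dc; rewrite -E2; exact: unc_pd_path_anc up2 x y.
(* If [m1] or [m2] is no ancestor of [a], direction propagates along one of the
   two paths. Otherwise [m1], [a] and [m2] lie in one component, which makes
   [m1] and [m2] inseparable. *)
have [m1A|m1A] := boolP (m1 ~> a); last first.
  have [am1'|aNm1] := boolP (a ~> m1); first exact: viab.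
  rewrite (negbTE aNm1) /= in am.
  by apply: viad => //; apply: (nonadj_no_scc sP nm m1a aNm1 am).
have [m2A|m2A] := boolP (m2 ~> a); last first.
  have [am2'|aNm2] := boolP (a ~> m2); first exact: viad.
  rewrite (negbTE aNm2) orbF in am.
  by have := nonadj_no_scc sP nm' m2a aNm2 am; rewrite m1A.
have am1' : a ~> m1.
  apply: contraT => aNm1; move: am; rewrite (negbTE aNm1) => am.
  by have := nonadj_no_scc sP nm m1a aNm1 am; rewrite m2A.
have am2' : a ~> m2.
  apply: contraT => aNm2.
  by have := nonadj_no_scc sP nm' m2a aNm2 am1'; rewrite m1A.
have [m1Nm2 nmm] := nonadj_not_inducing sP nm; case: nmm; split=> //.
have sD : sc G m2 \subset an_set G [set m1; m2].
  by apply/subsetP => z; rewrite in_sc in_an2 => /andP[-> _]; rewrite orbT.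
apply: soft_conn_flags (scc_soft_conn _ _ _ sD) => //; first exact/eqP.
  exact: connect_trans m1A am2'.
exact: connect_trans m2A am1'.
Qed.

Lemma run_sound (R : mixed_graph V -> mixed_graph V -> Prop) P Q :
    (forall P Q, sound P -> R P Q -> sound Q) ->
  clos_refl_trans_1n _ R P Q -> sound P -> sound Q.
Proof.
move=> step; elim=> // {}P P' {}Q PP' _ IH sP.
by apply: IH; apply: step PP'.
Qed.

(** Every node of the witnessing collider path differs from [j], so its edges are
those of [P]. The arrowhead at [k] makes it possible to glue its inducing walk
to the given one, whose end at [k] is soft; everything lies among the
ancestors of [j] and [c]. *)
Lemma not_definitely_visible P k j : sound P -> adj P k j -> k ~> j ->
    soft_conn G (an_set G [set j]) setT true false k j ->
  ~ definitely_visible (orient_dir P k j) k j.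
Proof.
move=> sP kj kaj wkj [_ [c [/andP[cNj ncj] vis]]].
have E u v : u != j -> v != j -> orient_dir P k j u v = P u v.
  by rewrite /orient_dir /set_mark => /negbTE uN /negbTE vN; rewrite uN vN andbF.
have nadj : ~~ adj P c j.
  apply: contra ncj; rewrite /adj /orient_dir /set_mark.
  by case: ifP => // _; case: ifP.
have [/eqP kNj _] := adj_inducing sP kj.
have [p [pth cP hd dP]] : exists p, [/\ path (adj P) c (rcons p k),
    all (collider P) (triples (c :: rcons p k)), into P (last c p) k
  & all [in an_set G [set c; j]] p].
  have [cN|[p [/andP[/andP[pth uq] cP] hd dP]]] := vis.
    have ck : into P c k by rewrite /into -E.
    by exists [::]; split=> //=; rewrite (into_adj ck).
  have pN : all [pred v | v != j] p.
    apply: sub_all dP => q; apply: contraTneq => ->.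
    rewrite /dir_edge /into /orient_dir /set_mark eqxx (eq_sym j k) (negbTE kNj) andbF.
    suff: ~~ adj P j j by rewrite /adj; case: (P j j); rewrite // andbF.
    by apply/negP => /(adj_inducing sP)[].
  have aN : all [pred v | v != j] (c :: rcons p k) by rewrite /= cNj all_rcons /= kNj.
  exists p; split.
  - rewrite -(eq_in_path (e := adj (orient_dir P k j)) (P := [pred v | v != j])) //.
    by move=> u v uN vN; rewrite /adj E.
  - elim: (rcons p k) (c) aN cP {pth uq} => [//|x s IH] y /andP[yN sN].
    case: s IH sN => [//|z s] IH sN /andP[cz cP].
    apply/andP; split; last exact: IH.
    case/and3P: sN => xN zN _.
    by move: cz; rewrite /= /into !E.
  - have cpN : all [pred v | v != j] (c :: p) by rewrite /= cNj.
    have lN : last c p != j := allP cpN _ (mem_last c p).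
    by move: hd; rewrite /into E.
  apply/allP => q qp; rewrite in_an2.
  have := allP dP q qp; have := allP pN q qp => /= qN.
  rewrite /dir_edge /tail_at /into /orient_dir /set_mark (negbTE qN) andbF eqxx /= andbT.
  have [-> _|qNk qj] := eqVneq q k; first by rewrite kaj orbT.
  by rewrite (sound_tail sP (x := j) (y := q)) ?orbT //; move: qj => /andP[].
have cD := an_set2l G c j; have jD := an_set2r G c j.
have kD : k \in an_set G [set c; j] by rewrite in_an2 kaj orbT.
have wck : soft_conn G (an_set G [set c; j]) setT false true c k.
  have := @collider_path_soft_conn P [set c; j] c p k sP pth cP.
  rewrite /= cD all_rcons kD => /(_ dP); apply: soft_conn_flags => //.
  by rewrite (sound_into sP hd).
case/negP: nadj; apply/(sound_adj sP); split; first exact/eqP.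
apply: soft_conn_cat wck (soft_conn_sub _ (subxx _) wkj) kD _ => //.
by apply: an_set_sub; rewrite sub1set.
Qed.

End Orientation.

(** * The initial orientations and the conclusion *)

(** The background orientations may overwrite arrowheads of unshielded triples at
context nodes, so the marks there are justified by the assumptions on [G]
alone. *)
Lemma initial_sound (V : finType) (G : dmg V) (K : {set V}) P0 sep :
    JCI123 G K -> skeleton (IM_sigma G) K P0 -> is_sepset (IM_sigma G) P0 sep ->
  (forall x y, x <> y -> ~ inducing G x y -> separates (IM_sigma G) (sep x y) x y) /\
  sound G K sep (background K (rule0 sep P0)).
Proof.
move=> hG sk [hsep sepC].
have P0E x y : (inducing G x y /\ P0 x y = Some Circle) \/ (~ inducing G x y /\ P0 x y = None).
  have [ic nc] := sk x y.
  have [xy|xy] := classic (inducing G x y); [left|right]; split=> //.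
    exact/ic/fci_adjP.
  by apply: nc => /(fci_adjP hG).
have adjE x y : adj P0 x y <-> inducing G x y.
  by rewrite /adj; case: (P0E x y) => -[xy ->].
have sepP x y : x <> y -> ~ inducing G x y -> separates (IM_sigma G) (sep x y) x y.
  move=> xNy nxy; apply: hsep; rewrite /nonadj; apply/andP; split; first exact/eqP.
  by apply/negP => /adjE.
split=> //.
have R0E x y : adj (rule0 sep P0) x y = adj P0 x y.
  by rewrite /rule0 /adj; case: ifP => // /andP[->].
have BE x y : adj (background K (rule0 sep P0)) x y = adj P0 x y.
  by rewrite -R0E /background [LHS]/adj; case: ifP => // xy; case: ifP => // _; case: ifP.
have inducingE x y : adj (rule0 sep P0) x y <-> inducing G x y by rewrite R0E.
split=> [x y|x y|x y|x y|x y z|x y].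
- by rewrite BE.
- rewrite /into /background; case: ifP => // /inducingE xy; case: ifP => [xK _|_].
    by apply/negP => yx; case: xy => + _; apply; rewrite (context_an hG xK yx).
  case: ifP => // _; rewrite /rule0; case: ifP => [|_]; last by case: (P0E x y) => -[_ ->].
  move=> /andP[_ /existsP[z /and3P[/adjE zy /andP[/eqP xNz /negP xz] yS]]] _.
  have nxz : ~ inducing G x z by move/adjE.
  by have /andP[] := notin_sep_nonanc sepP xNz nxz xy (inducing_sym zy) yS.
- rewrite /tail_at /background; case: ifP => // /inducingE xy; case: ifP => // /negbT xK.
  case: ifP => [yK _|_]; first exact: (context_inducing_an hG yK xK (inducing_sym xy)).
  by rewrite /rule0; case: ifP => // _; case: (P0E x y) => -[_ ->].
- rewrite /tail_at /into /background; case: ifP => // /inducingE xy; case: ifP => // xK.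
  have yx : adj (rule0 sep P0) y x by apply/inducingE/inducing_sym.
  case: ifP => [yK|_]; first by rewrite yx.
  by rewrite /rule0; case: ifP => // _; case: (P0E x y) => -[_ ->].
- rewrite /nonadj !BE /circ_at /background; case: ifP => // xy; case: ifP => // _.
  case: ifP => // _; rewrite /rule0; case: ifP => // /negbT.
  rewrite -R0E xy /= => /existsPn/(_ z) + _ zy xz.
  by rewrite /nonadj zy xz /= negbK.
by rewrite /circ_at /background; case: ifP => // _; case: ifP => // _; case: ifP.
Qed.

(** Being an ancestor of [j] excludes an arrowhead at [k]; a tail always faces an
arrowhead, which excludes the remaining combinations of marks. *)
Lemma anc_possibly_directed (V : finType) (G : dmg V) K sep (P : mixed_graph V) k j :
    sound G K sep P -> adj P k j -> connect (dir G) k j ->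
  [|| circ_circ P k j, circ_to P k j | dir_edge P k j].
Proof.
move=> sP kj kaj; have jk : adj P j k by rewrite (adj_sym sP).
have hk : ~~ into P j k by apply: contraL kaj => /(sound_into sP).
rewrite /circ_circ /circ_to /dir_edge.
have nt : ~~ tail_at P k j by apply: contra hk => /(sound_tail_into sP).
have := @sound_tail_into _ _ _ _ _ sP j k.
move: kj jk hk nt; rewrite /adj /into /tail_at /circ_at.
by case: (P k j) => [[]|] //; case: (P j k) => [[]|] // _ _ _ _ /(_ isT).
Qed.

Theorem proposition11 (V : finType) (K : {set V}) (G : dmg V)
    (P : mixed_graph V)
    (hG : JCI123 G K) (hP : fci_jci_output (IM_sigma G) K P)
    (i j : V) (hi : i \in K) (hj : j \in ~: K) :
  (~~ adj P i j -> ~~ dir G i j) /\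
  (dir_edge P i j ->
   (forall k : V, k \in ~: K -> dir_edge P i k ->
      [|| circ_circ P k j, circ_to P k j | dir_edge P k j] ->
      definitely_visible (orient_dir P k j) k j) ->
   dir G i j).
Proof.
case: hP => P0 [sep [P1 [sk hsep [r14 _] [r8 _]]]].
have [sepP s0] := initial_sound hG sk hsep.
have sP : sound G K sep P.
  apply: (run_sound (fun P Q => @rules8_10_sound _ _ K _ sepP P Q) r8).
  exact: (run_sound (fun P Q => @rules1_4_sound _ _ K _ sepP P Q) r14).
split; first by apply: contra => /inducing_dir/(sound_adj sP).
move: hj; rewrite inE => jK /andP[_ /into_adj /(adj_inducing sP) ij] visible.
have [iNj] := (fci_adjP hG i j).2 ij; case=> [[_ jK']|nsep]; first by rewrite jK' in jK.
have [[|[e k] w] [w0 gw wE _ _]] := inseparable_soft_conn (elimN eqP iNj) nsep.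
  by case: w0.
have [|eF kK] := context_start hG hi gw; first by rewrite -wE in jK.
rewrite eF in gw; move: gw; rewrite soft_walk_cons => /and3P[/= ik gw kD].
case: w => [|[f l] w] in wE gw kD {w0} *; first by rewrite -[j]wE.
(* [i] is the only ancestor of [i], so the inner nodes are ancestors of [j]. *)
have inD z : z \in an_set G [set i; j] :\: [set i; j] -> (z != j) && connect (dir G) z j.
  rewrite in_setD in_set2 negb_or in_an2.
  move=> /andP[/andP[zi ->]] /orP[/(context_an hG hi) zE|//].
  by rewrite zE eqxx in zi.
move: kD; rewrite in_setT implyTb => /andP[/inD/andP[kNj kj] sf].
have wkj : soft_conn G (an_set G [set j]) setT true false k j.
  exists ((f, l) :: w); split=> //; apply: soft_walk_sub gw => //.
  by apply/subsetP => z /inD/andP[_ zj]; apply/an_setP; exists j; rewrite ?set11.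
have akj : adj P k j.
  apply/(sound_adj sP); split; first exact/eqP.
  apply: soft_conn_flags (soft_conn_sub _ (subxx _) wkj) => //.
  by apply: an_set_sub; rewrite sub1set an_set2r.
case: (not_definitely_visible sP akj kj wkj); apply: visible.
- by rewrite inE.
- have aik : adj P i k by apply/(sound_adj sP)/inducing_dir.
  have aki : adj P k i by rewrite (adj_sym sP).
  suff ti : tail_at P k i by rewrite /dir_edge ti (sound_tail_into sP ti).
  move: aki; rewrite /adj /tail_at; case E: (P k i) => [[]|] // _.
    have : into P k i by rewrite /into E.
    by move/(sound_into sP); rewrite (connect1 ik).
  have : circ_at P k i by rewrite /circ_at E.
  by move/(sound_circ_system sP); rewrite hi andbF.
exact: (anc_possibly_directed sP akj kj).
Qed.
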